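(* There are subsets $A,B,C$ of the Baire space $\omega^\omega$ such that (i) $A$ is $l$-measurable and not $s$-measurable; (ii) $B$ is $m$-measurable but not $s$-measurable; (iii) $C$ is $l$-measurable but not $m$-measurable. Moreover, if $\mathfrak{b}=\mathfrak{c}$ then (iv) there is a subset of $\omega^\omega$ which is not $l$-measurable but is $s$-measurable; (v) there is a subset of $\omega^\omega$ which is not $m$-measurable but is $s$-measurable.
   Context: $\mathfrak{c}=2^{\aleph_0}$. For $x,y\in\omega^\omega$, $y\le^* x$ means $y(n)\le x(n)$ for all but finitely many $n$. The bounding number is $\mathfrak{b}=\min\{|\mathcal{B}|:\ \mathcal{B}\subseteq\omega^\omega\ \wedge\ (\forall x\in\omega^\omega)(\exists y\in\mathcal{B})\ \neg(y\le^* x)\}$. A tree $T\subseteq\omega^{<\omega}$ is a set of finite sequences closed under initial segments; $[T]=\{x\in\omega^\omega: (\forall n\in\omega)\ x\upharpoonright n\in T\}$. A node $t\in T$ is infinitely splitting if $\{n\in\omega: t^\frown n\in T\}$ is infinite. A tree $T$ is a Laver tree if there is a node $s\in T$ such that every node $t\in T$ with $s\subseteq t$ is infinitely splitting. A tree $T$ is a Miller tree if there is a node $s\in T$ such that for every node $t\in T$ with $s\subseteq t$ there is $t'\in T$ with $t\subseteq t'$ and $t'$ infinitely splitting. A set $A\subseteq\omega^\omega$ is: - $s$-measurable if for every nonempty perfect set $P\subseteq\omega^\omega$ there is a nonempty perfect set $Q\subseteq P$ with $Q\subseteq A$ or $Q\cap A=\emptyset$; - $l$-measurable if for every Laver tree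 $T$ there is a Laver tree $S\subseteq T$ with $[S]\subseteq A$ or $[S]\cap A=\emptyset$; - $m$-measurable if for every Miller tree $T$ there is a Miller tree $S\subseteq T$ with $[S]\subseteq A$ or $[S]\cap A=\emptyset$. *)

(* Defs.v *)
From mathcomp Require Import all_boot.
From mathcomp Require Import boolp classical_sets functions cardinality.
From mathcomp Require Import topology.

Set Implicit Arguments.
Unset Strict Implicit.
Unset Printing Implicit Defensive.

Local Open Scope classical_set_scope.
Local Open Scope card_scope.

(* [prod_topology] carries the product topology of the discrete space [nat]. *)
Notation baire := (prod_topology (fun _ : nat => nat)).

Definition eventually_le (y x : baire) : Prop :=
  finite_set [set n | ~~ (y n <= x n)].

Definition unbounded_family (B : set baire) : Prop :=
  forall x : baire, exists2 y, B y & ~ eventually_le y x.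

(* Cardinals are represented by sets up to [#=]: this says that the minimum of
   the cardinalities of the unbounded families exists and is that of [K]. *)
Definition bounding_number_eq (T : Type) (K : set T) : Prop :=
  (exists2 B, unbounded_family B & B #= K) /\
  (forall B, unbounded_family B -> K #<= B).

Definition continuum : set (set nat) := [set: set nat].

Definition b_eq_c : Prop := bounding_number_eq continuum.

Definition is_tree (T : set (seq nat)) : Prop :=
  forall s t : seq nat, prefix s t -> T t -> T s.

(* [mkseq x n] is the restriction of [x] to [n]. *)
Definition branches (T : set (seq nat)) : set baire :=
  [set x | forall n, T (mkseq x n)].

Definition infinitely_splitting (T : set (seq nat)) (t : seq nat) : Prop :=
  infinite_set [set n | T (rcons t n)].

Definition laver_tree (T : set (seq nat)) : Prop :=
  is_tree T /\
  exists2 s, T s & forall t, T t -> prefix s t -> infinitely_splitting T t.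

Definition miller_tree (T : set (seq nat)) : Prop :=
  is_tree T /\
  exists2 s, T s & forall t, T t -> prefix s t ->
    exists t', [/\ T t', prefix t t' & infinitely_splitting T t'].

Definition s_measurable (A : set baire) : Prop :=
  forall P : set baire, perfect_set P -> P !=set0 ->
  exists Q : set baire, [/\ perfect_set Q, Q !=set0, Q `<=` P &
    Q `<=` A \/ Q `&` A = set0].

Definition l_measurable (A : set baire) : Prop :=
  forall T, laver_tree T ->
  exists S, [/\ laver_tree S, S `<=` T &
    branches S `<=` A \/ branches S `&` A = set0].

Definition m_measurable (A : set baire) : Prop :=
  forall T, miller_tree T ->
  exists S, [/\ miller_tree S, S `<=` T &
    branches S `<=` A \/ branches S `&` A = set0].

(* Main.v *)
Require Import Defs.
From Stdlib Require Import Inverse_Image.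
From mathcomp Require Import all_boot.
From mathcomp Require Import boolp classical_sets functions cardinality.
From mathcomp Require Import wochoice topology cantor.

(** The sets of the first half are pieces of a Bernstein set: a set [D] such
    that both [D] and its complement meet the branches of every splitting tree,
    hence every nonempty perfect set ([bernstein_set]). Let [W] be a tree from
    which every Laver tree [T] escapes, in the sense that some node of [T]
    above the stem is not in [W]. Then the part of [T] through this node is a
    Laver tree sharing no branch with [W], so that every set of branches of [W]
    is [l]-measurable; the same holds for Miller trees
    ([escape_tree_measurable]). Laver and Miller trees both escape from the
    binary tree, whereas [D] splits all its perfect subsets: the trace of [D]
    on the Cantor set is [l]- and [m]-measurable and not [s]-measurable. Laver
    trees also escape from the tree of the sequences that vanish at odd places,
    which is a Miller tree, and [D] splits all its Miller subtrees: the trace of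
    [D] on its branches is [l]-measurable and not [m]-measurable.

    For the second half, one set serves both claims. Enumerate all functions as
    [g i] and all Miller trees along a well-order of type continuum, and choose
    branches [x i] of the trees, on both sides, such that [x i] is eventually
    dominated by no [max (x j) (g j)] with [j] before [i]. Fewer than continuum
    many functions have to be avoided at each stage; since b = c they have a
    common eventual bound, and a Miller tree has branches that escape any single
    bound ([miller_unbounded]). The resulting set splits all Miller trees, hence
    all Laver trees, and is not measurable for either. But fewer than continuum
    many of its elements lie below any given function. A perfect set contains a
    copy of the Cantor space, which is bounded, and this copy consists of
    continuum many disjoint perfect sets, one of which must avoid the set
    ([small_bounded_s_measurable]).

    Both constructions are instances of a single transfinite recursion,
    [two_sided_transversal]. *)

Set Implicit Arguments.
Unset Strict Implicit.
Unset Printing Implicit Defensive.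

Local Open Scope classical_set_scope.
Local Open Scope card_scope.

(** * Sets smaller than the continuum *)

Definition small (T : Type) (A : set T) : Prop := ~ (continuum #<= A).

Lemma small_subset (T : Type) (A B : set T) : A `<=` B -> small B -> small A.
Proof. by move=> AB sB cA; apply/sB/(card_le_trans cA)/subset_card_le. Qed.

Lemma small_image (T U : Type) (f : T -> U) (A : set T) :
  small A -> small (f @` A).
Proof. by move=> sA cA; apply/sA/(card_le_trans cA)/card_image_le. Qed.

Lemma continuum_le_injection (T : Type) (A : set T) (f : set nat -> T) :
  injective f -> (forall i, A (f i)) -> continuum #<= A.
Proof.
move=> injf Af; suff /inj_card_eq : {in continuum &, injective f}.
  rewrite card_eq_le => /andP[_ /card_le_trans]; apply; apply: subset_card_le.
  by move=> _ [i _ <-].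
by move=> i j _ _; exact: injf.
Qed.

Lemma small_avoid (T : Type) (A : set T) (f : (nat -> bool) -> T) :
  small A -> injective f -> exists a, ~ A (f a).
Proof.
move=> sA injf; apply: contrapT => /forallNP Af; apply: sA.
pose g (i : set nat) := f (fun n => `[< i n >]).
apply: (@continuum_le_injection _ _ g).
  move=> i j /injf ij; apply/funext => n; apply/propext.
  by apply: (iff_trans (rwP (asboolP _))); rewrite (congr1 (@^~ n) ij);
    apply: iff_sym; exact: (rwP (asboolP _)).
by move=> i; exact: contrapT (Af _).
Qed.

Lemma continuum_le_inv (T : pointedType) (A : set T) :
  continuum #<= A -> exists2 f : set nat -> T, injective f & forall i, A (f i).
Proof.
move/pcard_leP/injfunPex => [f Af injf]; exists f; last by move=> i; exact: Af.
by move=> i j; apply: injf; rewrite inE.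
Qed.

(** Split an injection of the continuum into two, according to a first bit: the
    point [x] is a value of at most one half. *)
Lemma small_setU1 (T : pointedType) (x : T) (A : set T) :
  small A -> small (x |` A).
Proof.
move=> sA /continuum_le_inv[f injf Af]; apply: sA.
pose e (b : Prop) (i : set nat) : set nat :=
  [set n | if n is m.+1 then i m else b].
have injfe b : injective (f \o e b).
  move=> i j /injf ij; apply/funext => n.
  exact: (congr1 (fun k : set nat => k n.+1) ij).
have [[b Ne]|/forallNP ex] := pselect (exists b, forall i, f (e b i) <> x).
  by apply: (continuum_le_injection (injfe b)) => i; have [/Ne|] := Af (e b i).
have xe b : exists i, f (e b i) = x.
  by have /existsNP[i /contrapT fi] := ex b; exists i.
have [i fi] := xe True; have [j fj] := xe False.
suff : False by [].
have /injf ij : f (e True i) = f (e False j) by rewrite fi.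
by rewrite -[False]/(e False j 0) -ij.
Qed.

(** * Transfinite recursion of length continuum *)

(** A well-order of the continuum all of whose initial segments, even the closed
    ones, are small. If an arbitrary well-order has an element with too many
    predecessors, then the least such element has a segment that can be used
    instead: the continuum embeds into it, and the order is pulled back. *)
Lemma continuum_well_order : exists lt : set nat -> set nat -> Prop,
  [/\ well_founded lt, forall i j, i <> j -> lt i j \/ lt j i &
      forall i, small [set j | ~ lt i j]].
Proof.
have [R Rwo] := well_ordering_principle (set nat).
have Rch : wo_chain R predT by move=> B _; exact: Rwo.
have Rtot i j : R i j || R j i by exact: (wo_chainW Rch).
have Ranti i j : R i j -> R j i -> i = j.
  by move=> ij ji; apply: (wo_chain_antisymmetric Rch) => //; rewrite ij.
have Rmin (B : set (set nat)) : B !=set0 ->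
    exists2 m, B m & forall i, B i -> R m i.
  move=> [i Bi]; have [|m [[/asboolP Bm mB] _]] := Rwo (fun j => `[< B j >]).
    by exists i; apply/asboolP.
  by exists m => // j Bj; apply: mB; apply/asboolP.
pose below j : set (set nat) := [set i | ~~ R j i].
have [f injf fsmall] : exists2 f : set nat -> set nat, injective f &
    forall j, small (below (f j)).
  have [/Rmin[m mlarge mmin]|nolarge] :=
    pselect ([set j | ~ small (below j)] !=set0).
    move: mlarge => /contrapT/continuum_le_inv[f injf fm]; exists f => // j.
    by apply: contrapT => /mmin; apply/negP; exact: fm.
  by exists id => // j; apply: contrapT => jlarge; apply: nolarge; exists j.
exists (fun i j => ~~ R (f j) (f i)); split.
- apply: (@wf_inverse_image _ _ (fun i j => ~~ R j i) f) => i.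
  apply: contrapT => Ni; have [|m NAm mmin] :=
    Rmin [set i | ~ Acc (fun i j => ~~ R j i) i]; first by exists i.
  apply: NAm; constructor => j; apply: contraNP => /mmin; exact.
- move=> i j ij; apply: contrapT => /not_orP[/negP/negPn ji /negP/negPn ij'].
  by apply/ij/injf/Ranti.
move=> i cj; apply: (small_setU1 (x := f i) (fsmall i)).
have [g injg gP] := continuum_le_inv cj.
apply: (continuum_le_injection (f := f \o g)) => [? ? /injf/injg//|j] /=.
have [<-|fgi] := eqVneq (f i) (f (g j)); [by left | right => /=].
apply: contra_neqN fgi => Rij; apply: Ranti => //.
by have /negP/negPn := gP j.
Qed.

(** [G i J x] says that [x] may be chosen at stage [i] after the choices
    recorded, with their stages, in [J]. *)
Lemma continuum_recursion (X : pointedType)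
    (G : set nat -> set (set nat * X) -> X -> Prop) :
  (forall i J, small J -> exists x, G i J x) ->
  exists (lt : set nat -> set nat -> Prop) (f : set nat -> X),
    [/\ forall i j, i <> j -> lt i j \/ lt j i,
        forall i, small [set j | ~ lt i j] &
        forall i, G i [set (j, f j) | j in [set j | lt j i]] (f i)].
Proof.
move=> Gex; have [lt [ltwf lttot ltsmall]] := continuum_well_order.
pose graph i (h : forall j, lt j i -> X) : set (set nat * X) :=
  [set p | exists ji : lt p.1 i, p.2 = h p.1 ji].
pose F i (h : forall j, lt j i -> X) : X := xget point (G i (graph i h)).
pose f := Fix ltwf (fun=> X) F.
have fE i : f i = xget point (G i [set (j, f j) | j in [set j | lt j i]]).
  rewrite /f Fix_eq => [|j h k hk].
    congr (xget _ (G i _)); apply/seteqP; split => [[j x] /= [/= ji ->]|].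
      by exists j.
    by move=> _ /= [j ji <-]; exists ji.
  rewrite /F; congr (xget _ (G j (graph j _))).
  by apply: functional_extensionality_dep => l; apply/funext => lj.
have asym i j : lt i j -> ~ lt j i.
  elim/(well_founded_ind ltwf): i j => i IH j ij ji; exact: (IH j ji i ji ij).
exists lt, f; split=> // i; rewrite [X in G i _ X]fE.
apply: xgetPex; apply: Gex.
rewrite -[X in small X]/((fun j => (j, f j)) @` _); apply: small_image.
by apply: small_subset (ltsmall i) => j /= /asym.
Qed.

Lemma subset_code (C : countType) :
  exists code : set nat -> set C, forall A, exists i, code i = A.
Proof.
exists (fun i => pickle @^-1` i) => A; exists (pickle @` A).
apply/seteqP; split=> [c [d Ad /(pcan_inj pickleK) <-]//|c Ac].
by exists c.
Qed.

(** Here [br A] is the set of points (branches) of an object (tree) coded by the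
    set [A], [C] is the class of objects to be split, and [bad i y] is what
    later choices avoid once [y] has been chosen at stage [i]. Every object is
    treated at two stages, once for [D] and once for its complement;
    reflexivity of [bad i] keeps the two choices apart. The second conclusion
    is the Luzin property: all but a small part of [D] is chosen after any
    given stage [i], and so avoids [bad i y] for the point [y] chosen there. *)
Lemma two_sided_transversal (T : countType) (X : pointedType)
    (br : set T -> set X) (C : set (set T)) (bad : set nat -> X -> set X) :
  C setT -> (forall i x, bad i x x) ->
  (forall A J, C A -> small J ->
    exists2 x, br A x & forall i y, J (i, y) -> ~ bad i y x) ->
  exists2 D : set X,
    forall A, C A -> br A `&` D !=set0 /\ br A `\` D !=set0 &
    forall i, exists2 S, small S &
      forall x, D x -> ~ S x -> exists y, ~ bad i y x.
Proof.
move=> CT bad_refl avoid; have [code codeP] := subset_code (option T).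
(* The value of a code at [None] tells for which side the stage works. *)
pose tree i :=
  if pselect (C (Some @^-1` code i)) then Some @^-1` code i else setT.
have treeC i : C (tree i) by rewrite /tree; case: pselect.
have treeP A (b : Prop) : C A -> exists2 i, tree i = A & code i None = b.
  move=> CA.
  have [i iA] := codeP [set o : option T | if o is Some s then A s else b].
  by exists i; rewrite /tree iA //; case: pselect.
have [|lt [f [lttot ltsmall fP]]] := @continuum_recursion X
  (fun i J x => br (tree i) x /\ forall j y, J (j, y) -> ~ bad j y x).
  by move=> i J sJ; have [x] := avoid (tree i) J (treeC i) sJ; exists x.
have lt_bad i j : lt i j -> ~ bad i (f i) (f j).
  by move=> ij; have [_] := fP j; apply; exists i.
have injf i j : f i = f j -> i = j.
  move=> ij; apply: contrapT => /lttot[] /lt_bad; rewrite ij; apply;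
  exact: bad_refl.
exists (f @` [set i | code i None]) => [A CA|i].
  have [i iA iD] := treeP A True CA; have [j jA jD] := treeP A False CA.
  split; [exists (f i)|exists (f j)]; rewrite -?iA -?jA; split.
  - by have [] := fP i.
  - by exists i; rewrite //= iD.
  - by rewrite iA -jA; have [] := fP j.
  - by move=> [k /= + /injf kj]; rewrite kj jD.
exists (f @` [set j | ~ lt i j]); first exact: small_image.
move=> _ [j _ <-] Sj; exists (f i); apply: lt_bad.
by apply: contrapT => ij; apply: Sj; exists j.
Qed.

(** * Sequences and branches *)

(** Lipschitz maps between sequence spaces: the entry [k] of the value depends
    on the entries up to [k] of the argument. This is continuity in a form from
    which bounds can be read off, the argument being a sequence of bits. *)
Definition causal (K : Type) (f : (nat -> bool) -> nat -> K) : Prop :=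
  forall a b k, (forall i, i <= k -> a i = b i) -> f a k = f b k.

Lemma eq_mkseqP (K : Type) (x y : nat -> K) (n : nat) :
  mkseq x n = mkseq y n <-> forall k, k < n -> x k = y k.
Proof.
split=> [xy k kn|xy]; first by rewrite -(nth_mkseq (x k) x kn) xy nth_mkseq.
apply: (@eq_from_nth _ (x 0)); rewrite !size_mkseq // => k kn.
by rewrite !nth_mkseq // xy.
Qed.

Lemma prefix_mkseq (K : eqType) (x : nat -> K) (m n : nat) :
  m <= n -> prefix (mkseq x m) (mkseq x n).
Proof.
by move=> /subnKC <-; rewrite /mkseq iotaD map_cat prefix_prefix.
Qed.

(** The union of an increasing chain of sequences. In the chains considered
    [size (e n)] is at least [n], so that [e k.+1] has an entry at [k] and the
    default value is never used. *)
Definition limit_branch (e : nat -> seq nat) : baire :=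
  fun k => nth 0 (e k.+1) k.

Lemma mkseq_limit_branch (e : nat -> seq nat) (n : nat) :
  (forall n, prefix (e n) (e n.+1)) -> (forall n, n <= size (e n)) ->
  mkseq (limit_branch e) (size (e n)) = e n.
Proof.
move=> e_prefix e_size.
have e_mono m p : m <= p -> prefix (e m) (e p).
  move=> /subnKC <-; elim: (p - m) => [|k IH].
    by rewrite addn0 prefix_refl.
  by rewrite addnS; exact: prefix_trans IH (e_prefix _).
have nth_prefix s t k : prefix s t -> k < size s -> nth 0 t k = nth 0 s k.
  by move=> /prefixP[r ->]; rewrite nth_cat => ->.
apply: (@eq_from_nth _ 0); rewrite size_mkseq // => k kn.
rewrite nth_mkseq // /limit_branch.
have /orP[/e_mono nk|/e_mono kn'] := leq_total n k.+1.
  exact: nth_prefix.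
by rewrite (nth_prefix _ _ _ kn').
Qed.

Definition climb (K : Type) (step : seq nat -> K -> seq nat) (s : seq nat)
    (a : nat -> K) : nat -> seq nat :=
  fix e n := if n is m.+1 then step (e m) (a m) else s.

Lemma climb_causal (K : Type) (step : seq nat -> K -> seq nat) (s : seq nat)
    (a b : nat -> K) (n : nat) :
  (forall i, i < n -> a i = b i) -> climb step s a n = climb step s b n.
Proof.
elim: n => //= n IH ab; rewrite IH => [|i /ltnW]; last exact: ab.
by rewrite ab.
Qed.

(** Everything that is asked of a branch below is arranged node by node: a
    step that stays in the tree above [s] and strictly lengthens nodes can be
    iterated, and the nodes it visits are initial segments of one branch. *)
Lemma climb_branch (K : Type) (T : set (seq nat)) (s : seq nat)
    (step : seq nat -> K -> seq nat) (a : nat -> K) :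
  is_tree T -> T s ->
  (forall t b, T t -> prefix s t ->
     [/\ T (step t b), prefix t (step t b) & size t < size (step t b)]) ->
  let e := climb step s a in
  [/\ forall n, [/\ T (e n), prefix s (e n) & n <= size (e n)],
      branches T (limit_branch e) &
      forall n, mkseq (limit_branch e) (size (e n)) = e n].
Proof.
move=> treeT Ts stepP e.
have eP n : [/\ T (e n), prefix s (e n) & n <= size (e n)].
  elim: n => [|n [Te se en]] /=; first by rewrite prefix_refl.
  have [Te' ee' lt_e] := stepP _ (a n) Te se.
  by split; [|exact: prefix_trans ee'|exact: leq_ltn_trans lt_e].
have e_prefix n : prefix (e n) (e n.+1).
  by have [Te se _] := eP n; have [] := stepP _ (a n) Te se.
have e_size n : n <= size (e n) by have [] := eP n.
have mkseq_e n := mkseq_limit_branch n e_prefix e_size.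
split=> // n; have [Te _ _] := eP n.
by apply: treeT Te; rewrite -(mkseq_e n) prefix_mkseq.
Qed.

Lemma infinite_set_gt (A : set nat) (m : nat) :
  infinite_set A -> exists2 n, A n & m < n.
Proof.
move=> infA; apply: contrapT => /forall2NP noA; apply: infA.
apply: sub_finite_set (finite_II m.+1) => n An /=.
by have [//|/negP] := noA n; rewrite -leqNgt.
Qed.

Lemma eventually_leP (x y : baire) :
  eventually_le y x <-> exists N, forall n, N <= n -> y n <= x n.
Proof.
split=> [fin|[N yx]]; last first.
  apply: sub_finite_set (finite_II N) => n /=; apply: contraNT.
  by rewrite -leqNgt; exact: yx.
have /finite_seqP[s sE] := fin; exists (\max_(i <- s) i).+1 => n Nn.
apply: contraTT Nn => xy; rewrite -leqNgt; apply: leq_bigmax_seq => //.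
by have : [set n | ~~ (y n <= x n)] n by []; rewrite sE.
Qed.

(** * Perfect sets *)

Lemma nbhs_cylinder (K : discreteTopologicalType)
    (x : prod_topology (fun _ : nat => K)) (n : nat) :
  nbhs x [set y | forall k, k < n -> y k = x k].
Proof.
have x_filter : Filter (nbhs x) := nbhs_filter x.
elim: n => [|n IH]; first by apply: filterS filterT => y _ k.
have xn : nbhs x [set y : prod_topology (fun _ : nat => K) | y n = x n].
  have /(_ [set x n]) h := @proj_continuous _ (fun _ : nat => K) n x.
  exact: (h (discrete_set1 _)).
apply: filterS (filterI IH xn) => y [yx yn] k.
by rewrite ltnS leq_eqVlt => /orP[/eqP ->|/yx].
Qed.

(** Conversely, cylinders form a basis. Otherwise there are points [y n] outside
    [U] agreeing with [x] below [n], and this sequence converges to [x]. *)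
Lemma nbhs_baireP (x : baire) (U : set baire) :
  nbhs x U <->
  exists n, forall y : baire, (forall k, k < n -> y k = x k) -> U y.
Proof.
split=> [xU|[n nU]]; last exact: filterS nU (nbhs_cylinder x n).
apply: contrapT => /forallNP noU.
have {}noU n : exists y : baire, (forall k, k < n -> y k = x k) /\ ~ U y.
  by have /existsNP[y /not_implyP] := noU n; exists y.
pose y n : baire := sval (cid (noU n)).
have yx n : (forall k, k < n -> y n k = x k) /\ ~ U (y n).
  exact: svalP (cid (noU n)).
have y_cvg : y @ \oo --> x.
  apply/cvg_sup => N V [W] [[Z] oZ <-] ZxN ZV.
  apply: (filterS ZV); rewrite nbhs_simpl; exists N.+1 => // i /= Ni.
  by rewrite (yx i).1.
have [N _ /(_ N (leqnn N))] := y_cvg _ xU; exact: (yx N).2.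
Qed.

Lemma causal_continuous (f : cantor_space -> baire) : causal f -> continuous f.
Proof.
move=> cf x U /nbhs_baireP[n nU].
have := @nbhs_cylinder bool x n; apply: filterS => y yx.
apply: nU => k kn; apply: cf => i ik; apply: yx; exact: leq_ltn_trans kn.
Qed.

(** The range is closed because the Cantor space is compact, and it has no
    isolated point: flipping the bit [n] of [a] moves [f a] by injectivity, but
    only from the entry [n] on. *)
Lemma perfect_range (f : (nat -> bool) -> baire) :
  causal f -> injective f -> perfect_set (range f).
Proof.
move=> cf injf; have clf : closed (range f).
  apply: compact_closed.
    by apply: hausdorff_product => ?; exact: discrete_hausdorff.
  apply: (@continuous_compact cantor_space baire).
    by apply: continuous_subspaceT; exact: causal_continuous.
  exact: cantor_space_compact.
split=> //; apply/seteqP; split=> [x /subset_limit_point|].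
  by rewrite -(closure_id _).1.
move=> _ [a _ <-] U /nbhs_baireP[n nU].
pose b i := if i == n then ~~ a i else a i.
exists (f b); split; last 2 first.
- by exists b.
- apply: nU => k kn; apply: cf => i ik.
  by rewrite /b (ltn_eqF (leq_ltn_trans ik kn)).
apply/eqP => /injf/(congr1 (@^~ n)); rewrite /b eqxx; by case: (a n).
Qed.

(** * Trees *)

(** The branches of such a tree include a nonempty perfect set, and conversely
    the initial segments of the elements of such a set form such a tree; Laver
    and Miller trees are of this kind too. *)
Definition splitting_tree (T : set (seq nat)) : Prop :=
  is_tree T /\
  exists2 s, T s & forall t, T t -> prefix s t ->
    exists u (n : bool -> nat),
      [/\ prefix t u, n true != n false & forall b, T (rcons u (n b))].

Lemma laver_miller (T : set (seq nat)) : laver_tree T -> miller_tree T.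
Proof.
move=> [treeT [s Ts Tsplit]]; split=> //; exists s => // t Tt st; exists t.
by split; [|exact: prefix_refl|exact: Tsplit].
Qed.

Lemma laver_setT : laver_tree setT.
Proof.
split=> //; exists [::] => // t _ _; rewrite /infinitely_splitting.
suff -> : [set n | [set: seq nat] (rcons t n)] = setT by exact: infinite_nat.
exact/seteqP.
Qed.

Lemma miller_splitting (T : set (seq nat)) : miller_tree T -> splitting_tree T.
Proof.
move=> [treeT [s Ts Tsplit]]; split=> //; exists s => // t Tt st.
have [u [Tu tu infu]] := Tsplit t Tt st.
have [i Ti _] := infinite_set_gt 0 infu.
have [j Tj ij] := infinite_set_gt i infu.
exists u, (fun b => if b then i else j).
by split=> //; [rewrite neq_ltn ij|case].
Qed.

(** The branches of a splitting tree contain a copy of the Cantor space: climb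
    from the stem, and at each splitting node that is met let the next bit
    choose the way. *)
Lemma splitting_tree_copy (T : set (seq nat)) : splitting_tree T ->
  exists f : (nat -> bool) -> baire,
    [/\ causal f, injective f & forall a, branches T (f a)].
Proof.
move=> [treeT [s Ts Tsplit]].
have split_ex t : exists v : seq nat * (bool -> nat), T t -> prefix s t ->
    [/\ prefix t v.1, v.2 true != v.2 false & forall b, T (rcons v.1 (v.2 b))].
  have [[Tt st]|NTt] := pselect (T t /\ prefix s t).
    by have [u [n H]] := Tsplit t Tt st; exists (u, n).
  by exists (t, fun=> 0) => Tt st; case: NTt.
have [v vP] := choice split_ex.
pose step t b := rcons (v t).1 ((v t).2 b).
have stepP t b : T t -> prefix s t ->
    [/\ T (step t b), prefix t (step t b) & size t < size (step t b)].
  move=> Tt st; have [tv _ Tv] := vP t Tt st; split; first exact: Tv.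
    exact: prefix_trans tv (prefix_rcons _ _).
  by rewrite size_rcons ltnS size_prefix.
have eP a := climb_branch a treeT Ts stepP.
exists (fun a => limit_branch (climb step s a)); split.
- by move=> a b k ab; rewrite /limit_branch (climb_causal (n := k.+1) _ _ ab).
- move=> a b fab; apply/funext => n.
  elim/ltn_ind: n => n /(climb_causal step s) e_n.
  have [/(_ n)[Te se _] _ /(_ n.+1)] := eP a; have [_ _ /(_ n.+1)] := eP b.
  (* Both climbs leave the same splitting node at step [n], and nodes at which
     they arrive have the same length. *)
  rewrite fab /= -e_n !size_rcons => -> /rcons_inj[].
  have [_ /eqP vn _] := vP _ Te se.
  by case: (a n) (b n) => -[] // /esym.
- by move=> a; have [] := eP a.
Qed.

(** Only finitely many values are possible at the entry [k], one for each choice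
    of [k.+1] bits. *)
Lemma causal_bounded (f : (nat -> bool) -> baire) :
  causal f -> exists g : baire, forall a k, f a k <= g k.
Proof.
move=> cf.
exists (fun k => \max_(t : k.+1.-tuple bool) f (nth false t) k) => a k.
rewrite (cf a (nth false [tuple of mkseq a k.+1])).
  exact: (leq_bigmax (F := fun t : k.+1.-tuple bool => f (nth false t) k)).
by move=> i ik; rewrite nth_mkseq.
Qed.

Definition initial_segments (P : set baire) : set (seq nat) :=
  [set s | exists2 x, P x & mkseq x (size s) = s].

Lemma branches_initial_segments (P : set baire) :
  closed P -> branches (initial_segments P) = P.
Proof.
move=> clP; apply/seteqP; split=> [x xP|x Px n]; last first.
  by exists x => //; rewrite size_mkseq.
apply: clP => U /nbhs_baireP[n nU].
have [y Py yx] := xP n; exists y; split=> //; apply: nU.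
by apply/eq_mkseqP; rewrite size_mkseq in yx.
Qed.

(** Above a node on a branch [x], a second branch [y] close to [x] gives a
    splitting node at the first place where the two differ. *)
Lemma initial_segments_splitting (P : set baire) :
  perfect_set P -> P !=set0 -> splitting_tree (initial_segments P).
Proof.
move=> [_ Plim] [x0 Px0]; split.
  move=> s t /prefixP[r ->] [x Px xt]; exists x => //.
  move: xt; rewrite size_cat /mkseq iotaD map_cat => /eqP.
  by rewrite eqseq_cat ?size_map ?size_iota // => /andP[/eqP].
exists [::]; first by exists x0.
move=> t [x Px xt] _.
have : limit_point P x by rewrite Plim.
move=> /(_ [set y | forall k, k < size t -> y k = x k]).
case=> [|y [/eqP yx Py xy]]; first by apply/nbhs_baireP; exists (size t).
have xy_ex : exists n, x n != y n.
  apply: contrapT => /forallNP xy_eq; apply: yx; apply/funext => n.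
  by have /negP/negPn/eqP := xy_eq n.
case: (ex_minnP xy_ex) => n xyn n_min.
have xy_n : mkseq x n = mkseq y n.
  apply/eq_mkseqP => k; rewrite ltnNge; apply: contraNeq; exact: n_min.
exists (mkseq x n), (fun b => if b then x n else y n); split=> //.
  rewrite -xt; apply: prefix_mkseq; rewrite leqNgt.
  by apply: contraNN xyn => /xy ->.
case; rewrite /initial_segments /= size_rcons size_mkseq.
  by exists x => //; rewrite mkseqS.
by exists y => //; rewrite mkseqS xy_n.
Qed.

(** * Bernstein sets and their traces *)

Definition splits (D : set baire) (T : set (seq nat)) : Prop :=
  branches T `&` D !=set0 /\ branches T `\` D !=set0.

Lemma bernstein_set :
  exists D : set baire, forall T, splitting_tree T -> splits D T.
Proof.
have [|//|T J ST sJ|D DP _] :=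
  @two_sided_transversal (seq nat) baire branches splitting_tree
    (fun _ y x => x = y).
- split=> //; exists [::] => // t _ _; exists t, nat_of_bool.
  by split=> //; exact: prefix_refl.
- have [f [_ injf fT]] := splitting_tree_copy ST.
  have [a Na] := small_avoid (small_image (f := snd) sJ) injf.
  exists (f a) => // i y Jiy fay; apply: Na; by exists (i, y).
by exists D.
Qed.

Lemma splits_not_s_measurable (D : set baire) (W : set (seq nat)) :
  (forall T, splitting_tree T -> splits D T) -> splitting_tree W ->
  ~ s_measurable (D `&` branches W).
Proof.
move=> DP /splitting_tree_copy[f [cf injf fW]] sD.
have [|Q [Qperf Q0 QP QD]] := sD _ (perfect_range cf injf).
  by exists (f (fun=> true)), (fun=> true).
have [] := DP _ (initial_segments_splitting Qperf Q0).
rewrite branches_initial_segments; last exact: Qperf.1.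
move=> [x [Qx Dx]] [y [Qy NDy]]; case: QD => [/(_ y Qy)[]//|QD].
have : (Q `&` (D `&` branches W)) x.
  by split=> //; split=> //; have [a _ <-] := QP _ Qx.
by rewrite QD.
Qed.

(** For Laver trees this is [l_measurable], for Miller trees [m_measurable]. *)
Definition tree_measurable (C : set (set (seq nat))) (A : set baire) : Prop :=
  forall T, C T ->
  exists S, [/\ C S, S `<=` T & branches S `<=` A \/ branches S `&` A = set0].

Lemma splits_not_tree_measurable (C : set (set (seq nat))) (D : set baire)
    (W : set (seq nat)) :
  (forall T, C T -> splits D T) -> C W ->
  ~ tree_measurable C (D `&` branches W).
Proof.
move=> DP CW mD; have [S [CS SW SD]] := mD W CW.
have [[x [Sx Dx]] [y [Sy NDy]]] := DP S CS.
case: SD => [/(_ y Sy)[]//|SD].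
have : (branches S `&` (D `&` branches W)) x.
  by split=> //; split=> // n; exact/SW/Sx.
by rewrite SD.
Qed.

(** * Escaping from a tree *)

Definition restrict_tree (T : set (seq nat)) (u : seq nat) : set (seq nat) :=
  [set t | T t /\ (prefix t u || prefix u t)].

Lemma is_tree_restrict (T : set (seq nat)) (u : seq nat) :
  is_tree T -> is_tree (restrict_tree T u).
Proof.
move=> treeT s t st [Tt tu]; split; first exact: treeT Tt.
have /orP[/(prefix_trans st) ->//|ut] := tu.
move: st ut; rewrite !prefixE => /eqP st /eqP ut; apply/orP.
have /orP[su|us] := leq_total (size s) (size u); [left|right].
  by rewrite -ut take_takel // st.
by rewrite -st take_takel // ut.
Qed.

(** All branches of [restrict_tree T u] pass through [u], and those of [W] do
    not. *)
Lemma escape_tree_measurable (C : set (set (seq nat))) (W : set (seq nat))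
    (X : set baire) :
  X `<=` branches W ->
  (forall T, C T -> exists2 u, ~ W u & C (restrict_tree T u)) ->
  tree_measurable C X.
Proof.
move=> XW escape T /escape[u NWu CTu].
exists (restrict_tree T u); split=> //; first by move=> t [].
right; rewrite -subset0 => x [xT /XW/(_ (size u))].
suff -> : mkseq x (size u) = u by [].
by have [_ /orP[]] := xT (size u); rewrite prefixE ?size_mkseq;
  rewrite take_oversize ?size_mkseq // => /eqP.
Qed.

Lemma restrict_laver (T : set (seq nat)) (u : seq nat) :
  is_tree T -> T u ->
  (forall t, T t -> prefix u t -> infinitely_splitting T t) ->
  laver_tree (restrict_tree T u).
Proof.
move=> treeT Tu usplit; split; first exact: is_tree_restrict.
exists u; first by split=> //; rewrite prefix_refl.
move=> t [Tt _] ut; apply: sub_infinite_set (usplit t Tt ut) => n /= Ttn.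
by split=> //; rewrite (prefix_trans ut (prefix_rcons _ _)) orbT.
Qed.

Lemma restrict_miller (T : set (seq nat)) (u : seq nat) :
  is_tree T -> T u ->
  (forall t, T t -> prefix u t ->
     exists t', [/\ T t', prefix t t' & infinitely_splitting T t']) ->
  miller_tree (restrict_tree T u).
Proof.
move=> treeT Tu usplit; split; first exact: is_tree_restrict.
exists u; first by split=> //; rewrite prefix_refl.
move=> t [Tt _] ut; have [t' [Tt' tt' inft']] := usplit t Tt ut.
have ut' := prefix_trans ut tt'.
exists t'; split=> //; first by split=> //; rewrite ut' orbT.
apply: sub_infinite_set inft' => n /= Ttn.
by split=> //; rewrite (prefix_trans ut' (prefix_rcons _ _)) orbT.
Qed.

Definition binary_tree : set (seq nat) := [set s | all (geq 1) s].

Lemma binary_tree_splitting : splitting_tree binary_tree.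
Proof.
split=> [s t /prefixP[r ->]|].
  by rewrite /binary_tree /= all_cat => /andP[].
exists [::] => // t Tt _; exists t, nat_of_bool.
split=> //; first exact: prefix_refl.
by case; rewrite /binary_tree /= all_rcons.
Qed.

Lemma not_binary_tree (u : seq nat) (n : nat) :
  1 < n -> ~ binary_tree (rcons u n).
Proof.
by move=> n1; rewrite /binary_tree /= all_rcons /= leqNgt n1.
Qed.

Lemma binary_tree_escape_laver (T : set (seq nat)) : laver_tree T ->
  exists2 u, ~ binary_tree u & laver_tree (restrict_tree T u).
Proof.
move=> [treeT [s Ts Tsplit]].
have [n Tn n1] := infinite_set_gt 1 (Tsplit s Ts (prefix_refl s)).
exists (rcons s n); first exact: not_binary_tree.
apply: restrict_laver => // t Tt st; apply: Tsplit => //.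
exact: prefix_trans (prefix_rcons _ _) st.
Qed.

Lemma binary_tree_escape_miller (T : set (seq nat)) : miller_tree T ->
  exists2 u, ~ binary_tree u & miller_tree (restrict_tree T u).
Proof.
move=> [treeT [s Ts Tsplit]].
have [v [_ sv infv]] := Tsplit s Ts (prefix_refl s).
have [n Tn n1] := infinite_set_gt 1 infv.
exists (rcons v n); first exact: not_binary_tree.
apply: restrict_miller => // t Tt st; apply: Tsplit => //.
exact: prefix_trans sv (prefix_trans (prefix_rcons _ _) st).
Qed.

(** As [nth] returns [0] beyond the end of [s], only entries of [s] matter. *)
Definition odd_zero_tree : set (seq nat) :=
  [set s | forall k, odd k -> nth 0 s k = 0].

Lemma odd_zero_tree_miller : miller_tree odd_zero_tree.
Proof.
split.
  move=> s t /prefixP[r ->] Tt k k_odd; have := Tt k k_odd; rewrite nth_cat.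
  by case: ltnP => // sk _; rewrite nth_default.
have infP t : odd_zero_tree t -> ~~ odd (size t) ->
    infinitely_splitting odd_zero_tree t.
  move=> Tt t_even; rewrite /infinitely_splitting.
  suff -> : [set n | odd_zero_tree (rcons t n)] = setT by exact: infinite_nat.
  apply/seteqP; split=> // n _ k k_odd; rewrite nth_rcons Tt //.
  case: (k =P size t) => [kt|_]; last by rewrite if_same.
  by rewrite -kt k_odd in t_even.
exists [::]; first by move=> k _; rewrite nth_nil.
move=> t Tt _; have [t_odd|t_even] := boolP (odd (size t)); last first.
  by exists t; split=> //; [exact: prefix_refl|exact: infP].
have Tt0 : odd_zero_tree (rcons t 0).
  by move=> k k_odd; rewrite nth_rcons Tt // !if_same.
exists (rcons t 0); split=> //; first exact: prefix_rcons.
by apply: infP => //; rewrite size_rcons /= t_odd.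
Qed.

(** Above the stem of a Laver tree every node splits, in particular one of odd
    length, and this one can be left by a nonzero value. *)
Lemma odd_zero_tree_escape_laver (T : set (seq nat)) : laver_tree T ->
  exists2 u, ~ odd_zero_tree u & laver_tree (restrict_tree T u).
Proof.
move=> [treeT [s Ts Tsplit]].
have child t : T t -> prefix s t ->
    exists n, [/\ 0 < n, T (rcons t n) & prefix s (rcons t n)].
  move=> Tt st; have [n Tn n0] := infinite_set_gt 0 (Tsplit t Tt st).
  by exists n; split=> //; exact: prefix_trans st (prefix_rcons _ _).
have [t [Tt st t_odd]] : exists t, [/\ T t, prefix s t & odd (size t)].
  have [s_odd|s_even] := boolP (odd (size s)).
    by exists s; rewrite prefix_refl.
  have [n [_ Tn sn]] := child s Ts (prefix_refl s).
  by exists (rcons s n); rewrite size_rcons.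
have [n [n0 Tn sn]] := child t Tt st.
exists (rcons t n).
  by move=> /(_ _ t_odd); rewrite nth_rcons ltnn eqxx => n_0; rewrite n_0 in n0.
apply: restrict_laver => // v Tv tv; apply: Tsplit => //.
exact: prefix_trans sn tv.
Qed.

(** * Unbounded transversals *)

(** Climb through infinitely splitting nodes, leaving each of them, [t] say,
    by a value above [g (size t)]. *)
Lemma miller_unbounded (T : set (seq nat)) (g : baire) : miller_tree T ->
  exists2 x, branches T x & ~ eventually_le x g.
Proof.
move=> [treeT [s Ts Tsplit]].
have split_ex t : exists v : seq nat * nat, T t -> prefix s t ->
    [/\ prefix t v.1, T (rcons v.1 v.2) & g (size v.1) < v.2].
  have [[Tt st]|NTt] := pselect (T t /\ prefix s t).
    have [u [_ tu infu]] := Tsplit t Tt st.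
    by have [n Tn gn] := infinite_set_gt (g (size u)) infu; exists (u, n).
  by exists (t, 0) => Tt st; case: NTt.
have [v vP] := choice split_ex.
pose step t (_ : unit) := rcons (v t).1 (v t).2.
have stepP t b : T t -> prefix s t ->
    [/\ T (step t b), prefix t (step t b) & size t < size (step t b)].
  move=> Tt st; have [tv Tv _] := vP t Tt st; split=> //.
    exact: prefix_trans tv (prefix_rcons _ _).
  by rewrite size_rcons ltnS size_prefix.
pose e := climb step s (fun=> tt).
have [eP Tx mkseq_e] := climb_branch (fun=> tt) treeT Ts stepP.
exists (limit_branch e) => // /eventually_leP[N xg].
have [Te se Ne] := eP N; have [ev _ gv] := vP _ Te se.
have := xg (size (v (e N)).1) (leq_trans Ne (size_prefix ev)).
have -> : limit_branch e (size (v (e N)).1) = (v (e N)).2.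
  by have := mkseq_e N.+1; rewrite /= size_rcons mkseqS => /rcons_inj[].
by rewrite leqNgt gv.
Qed.

Definition interleave (a z : nat -> bool) (k : nat) : bool :=
  if odd k then z k./2 else a k./2.

Lemma interleave_inj (a b y z : nat -> bool) :
  interleave a y = interleave b z -> a = b /\ y = z.
Proof.
move=> ab; split; apply/funext => n.
  by have := congr1 (@^~ n.*2) ab; rewrite /interleave odd_double doubleK.
have := congr1 (@^~ n.*2.+1) ab.
by rewrite /interleave /= odd_double uphalf_double.
Qed.

Lemma causal_interleave (f : (nat -> bool) -> baire) (a : nat -> bool) :
  causal f -> causal (fun z => f (interleave a z)).
Proof.
move=> cf y z k yz; apply: cf => i ik; rewrite /interleave yz //.
by apply: leq_trans ik; rewrite leq_half_double -addnn -addnS leq_addr.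
Qed.

(** For a copy [f] of the Cantor space in a perfect set, the sets of all
    [f (interleave a z)] with [a] fixed are perfect, pairwise disjoint,
    continuum many, and all below one function [g]; [D] is too small below
    [g] to meet all of them. *)
Lemma small_bounded_s_measurable (D : set baire) :
  (forall g : baire, exists2 S : set baire, small S &
     forall x, D x -> (forall n, x n <= g n) -> S x) ->
  s_measurable D.
Proof.
move=> Dsmall P Pperf P0.
have [f [cf injf fP]] :=
  splitting_tree_copy (initial_segments_splitting Pperf P0).
rewrite branches_initial_segments in fP; last exact: Pperf.1.
have [g fg] := causal_bounded cf.
have [S sS DS] := Dsmall g.
have [a Da] : exists a, forall z, ~ D (f (interleave a z)).
  apply: contrapT => /forallNP Dmeets.
  have /choice[z Dz] a : exists z, D (f (interleave a z)).
    by have /existsNP[z /contrapT] := Dmeets a; exists z.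
  have [|a Na] := small_avoid (f := fun a => f (interleave a (z a))) sS.
    by move=> a b /injf/interleave_inj[].
  by apply: Na; apply: DS.
exists (range (fun z => f (interleave a z))); split.
- apply: perfect_range; first exact: causal_interleave.
  by move=> y z /injf/interleave_inj[].
- by exists (f (interleave a xpredT)), xpredT.
- by move=> _ [z _ <-].
- by right; rewrite -subset0 => _ [[z _ <-] /Da].
Qed.

Lemma b_eq_c_bounded (F : set baire) : b_eq_c -> small F ->
  exists g, forall y, F y -> eventually_le y g.
Proof.
move=> [_ bc] sF; apply: contrapT => /forallNP unb; apply: sF; apply: bc => x.
by have /existsNP[y /not_implyP[Fy yx]] := unb x; exists y.
Qed.

(** The point [y] chosen at stage [i] forbids all [x] that are eventually below
    [cap i y]. Including [y] itself keeps the points apart, and including [g i]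
    makes all later points escape from [g i]. *)
Lemma b_eq_c_luzin_set : b_eq_c -> exists D : set baire,
  (forall T, miller_tree T -> splits D T) /\ s_measurable D.
Proof.
move=> bc; have [code codeP] := subset_code (nat * nat)%type.
pose g i : baire := fun n => xget 0 [set m | code i (n, m)].
have gP (h : baire) : exists i, g i = h.
  have [i iE] := codeP [set p | h p.1 = p.2]; exists i; apply/funext => n.
  by rewrite /g iE; case: xgetP => //= /(_ (h n)).
pose cap i (y : baire) : baire := fun n => maxn (y n) (g i n).
have [|i x|T J mT sJ|D DP Dsmall] :=
  @two_sided_transversal (seq nat) baire branches miller_tree
    (fun i y x => eventually_le x (cap i y)).
- exact: laver_miller laver_setT.
- by apply/eventually_leP; exists 0 => n _; exact: leq_maxl.
- have [h hP] := b_eq_c_bounded bc (small_image (f := fun p => cap p.1 p.2) sJ).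
  have [x Tx xh] := miller_unbounded h mT; exists x => // i y Jiy.
  have /eventually_leP[M yh] : eventually_le (cap i y) h.
    by apply: hP; exists (i, y).
  move=> /eventually_leP[N xy]; apply/xh/eventually_leP; exists (maxn M N) => n.
  rewrite geq_max => /andP[Mn Nn]; exact: leq_trans (xy n Nn) (yh n Mn).
exists D; split=> //; apply: small_bounded_s_measurable => h.
have [i ih] := gP h; have [S sS DS] := Dsmall i; exists S => // x Dx xh.
apply: contrapT => /(DS x Dx)[y]; apply; apply/eventually_leP; exists 0 => n _.
by apply: leq_trans (xh n) _; rewrite /cap ih leq_maxr.
Qed.

Theorem theorem2p7 :
  (exists A B C : set baire,
     [/\ l_measurable A /\ ~ s_measurable A,
         m_measurable B /\ ~ s_measurable B &
         l_measurable C /\ ~ m_measurable C]) /\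
  (b_eq_c ->
     (exists D : set baire, ~ l_measurable D /\ s_measurable D) /\
     (exists E : set baire, ~ m_measurable E /\ s_measurable E)).
Proof.
split.
  have [D DP] := bernstein_set.
  exists (D `&` branches binary_tree), (D `&` branches binary_tree),
         (D `&` branches odd_zero_tree).
  have Dbin := splits_not_s_measurable DP binary_tree_splitting.
  split; split=> //.
  - exact: escape_tree_measurable (@subIsetr _ _ _) binary_tree_escape_laver.
  - exact: escape_tree_measurable (@subIsetr _ _ _) binary_tree_escape_miller.
  - exact: escape_tree_measurable (@subIsetr _ _ _) odd_zero_tree_escape_laver.
  - apply: splits_not_tree_measurable odd_zero_tree_miller.
    by move=> T /miller_splitting/DP.
move=> /b_eq_c_luzin_set[D [DP sD]].
rewrite -[D]setIT -[setT](_ : branches setT = setT) in sD *; last exact/seteqP.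
split; exists (D `&` branches setT); split=> //.
  apply: splits_not_tree_measurable laver_setT.
  by move=> T /laver_miller/DP.
exact: splits_not_tree_measurable (laver_miller laver_setT).
Qed.
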